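(* The element $$W=\sum_{i,j\in I}\widetilde\varepsilon_{ij}\cdot\{A_i,A_j\}\in K_2(\mathbb Q(\mathcal A)),\qquad\widetilde\varepsilon_{ij}=d_i\varepsilon_{ij},$$ does not depend on the choice of the cluster coordinate system $\{A_i\}$; that is, the elements defined by this formula for all seeds equivalent to a given one coincide after the identification of the function fields by cluster transformations.
   Context: A seed $\mathbf i=(I,I_0,\varepsilon,d)$ consists of a finite set $I$, a subset $I_0\subset I$ of frozen elements, a $\mathbb Q$-valued function $\varepsilon=(\varepsilon_{ij})$ on $I\times I$ with $\varepsilon_{ij}\in\mathbb Z$ unless $(i,j)\in I_0\times I_0$, and positive integers $\{d_i\}_{i\in I}$ with greatest common divisor $1$ such that $\varepsilon_{ij}d_j^{-1}$ is skew-symmetric. For $k\in I\setminus I_0$ the mutated seed $\mu_k(\mathbf i)=(I,I_0,\varepsilon',d)$ is given by $\varepsilon'_{ij}=-\varepsilon_{ij}$ if $k\in\{i,j\}$; $\varepsilon'_{ij}=\varepsilon_{ij}$ if $k\notin\{i,j\}$ and $\varepsilon_{ik}\varepsilon_{kj}\le 0$; $\varepsilon'_{ij}=\varepsilon_{ij}+|\varepsilon_{ik}|\varepsilon_{kj}$ if $k\notin\{i,j\}$ and $\varepsilon_{ik}\varepsilon_{kj}>0$. The seed torus $\mathcal A_{\mathbf i}$ is the split torus with coordinates $\{A_i\}_{i\in I}$; mutations induce birational maps $\mathcal A_{\mathbf i}\to\mathcal A_{\mu_k(\mathbf i)}$, $$A_k\,\mu_k^*A'_k=\prod_{\varepsilon_{kj}>0}A_j^{\varepsilon_{kj}}+\prod_{\varepsilon_{kj}<0}A_j^{-\varepsilon_{kj}},\qquad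 \mu_k^*A'_i=A_i\ (i\neq k),$$ and seed isomorphisms (bijections of index sets preserving the frozen elements, $\varepsilon$ and $d$) act by relabelling. Cluster transformations are compositions of these, and seeds related by them are called equivalent. $\mathbb Q(\mathcal A)$ is the field of rational functions on $\mathcal A_{\mathbf i}$, identified for all equivalent seeds by these maps; the $\{A_i\}$ of each seed form a cluster coordinate system. For a field $F$, $K_2(F)$ is the Milnor group: the quotient of $F^*\otimes F^*$ by the subgroup generated by $(1-x)\otimes x$, $x\in F^*\setminus\{1\}$; $\{x,y\}$ is the class of $x\otimes y$.
   Formalization: Since ε̃_ij may be non-integral when i and j are both frozen, W is then undefined in K_2(Q(A)); the formal statement proves equality in K_2(Q(A))⊗Q for all seeds, and in K_2(Q(A)) itself when all ε̃_ij are integers. *)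

(* Defs.v *)
From HB Require Import structures.
From mathcomp Require Import all_boot all_order all_algebra.
From mathcomp Require Import fraction generic_quotient ring_quotient.
From mathcomp Require Import boolp.
From mathcomp.multinomials Require Import freeg mpoly.
From mathcomp Require Import ring.

Set Implicit Arguments.
Unset Strict Implicit.
Unset Printing Implicit Defensive.

Import Order.TTheory GRing.Theory Num.Theory.
Local Open Scope ring_scope.
Local Open Scope quotient_scope.

(* V / <P>, the quotient by the subgroup generated by the elements satisfying P. *)
Section QuotientBy.
Variables (V : zmodType) (P : V -> Prop).

Inductive gen_subgroup : V -> Prop :=
| gen_subgroup0 : gen_subgroup 0
| gen_subgroup_mem x : P x -> gen_subgroup x
| gen_subgroupB x y : gen_subgroup x -> gen_subgroup y -> gen_subgroup (x - y).

Definition gen_subgroup_pred : pred V := fun x => `[< gen_subgroup x >].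

Lemma gen_subgroup_zmod_closed : zmod_closed gen_subgroup_pred.
Proof.
split; first by apply/asboolP; exact: gen_subgroup0.
by move=> x y /asboolP hx /asboolP hy; apply/asboolP; exact: gen_subgroupB.
Qed.

HB.instance Definition _ :=
  GRing.isZmodClosed.Build V gen_subgroup_pred gen_subgroup_zmod_closed.

Definition gen_subgroup_closed : zmodClosed V :=
  GRing.ZmodClosed.clone V gen_subgroup_pred _.

Definition quotient_by : zmodType := Quotient.quot gen_subgroup_closed.

Definition quotient_class (x : V) : quotient_by :=
  \pi_(Quotient.quot gen_subgroup_closed) x.

Lemma quotient_classB : {morph quotient_class : x y / x - y}.
Proof. by move=> x y; rewrite /quotient_class; exact: raddfB. Qed.

Lemma quotient_class_eq x y :
  quotient_class x = quotient_class y <-> gen_subgroup (x - y).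
Proof.
rewrite -(asboolE (gen_subgroup _)) -[asbool _]/(x - y \in gen_subgroup_closed).
by rewrite Quotient.idealrBE; split=> /eqP.
Qed.

End QuotientBy.

Section Tensor.
Variables A B : zmodType.

Inductive tensor_relation : {freeg (A * B)%type} -> Prop :=
| tensor_relationDl a a' b :
    tensor_relation (<< (a + a', b) >> - << (a, b) >> - << (a', b) >>)
| tensor_relationDr a b b' :
    tensor_relation (<< (a, b + b') >> - << (a, b) >> - << (a, b') >>).

Definition tensor : zmodType := quotient_by tensor_relation.

Definition tens (a : A) (b : B) : tensor :=
  quotient_class tensor_relation << (a, b) >>.

Lemma tensDl b : {morph tens^~ b : a a' / a + a'}.
Proof.
move=> a a'; apply/eqP; rewrite -subr_eq0 opprD addrA; apply/eqP.
rewrite /tens -!quotient_classB -[RHS](subrr (quotient_class _ 0)).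
rewrite -quotient_classB; apply/quotient_class_eq; rewrite subrr subr0.
by apply: gen_subgroup_mem; left.
Qed.

Lemma tensDr a : {morph tens a : b b' / b + b'}.
Proof.
move=> b b'; apply/eqP; rewrite -subr_eq0 opprD addrA; apply/eqP.
rewrite /tens -!quotient_classB -[RHS](subrr (quotient_class _ 0)).
rewrite -quotient_classB; apply/quotient_class_eq; rewrite subrr subr0.
by apply: gen_subgroup_mem; right.
Qed.

End Tensor.

(* The multiplicative group F^*, written additively: the sum of two elements
   of [units F] is their product in F. *)
Record units (F : fieldType) := Units { units_val :> F; _ : units_val != 0 }.

HB.instance Definition _ F := [isSub for @units_val F].
HB.instance Definition _ F := [Choice of units F by <:].

Lemma units_neq0 F (x : units F) : val x != 0.
Proof. exact: valP x. Qed.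

Section UnitsZmod.
Variable F : fieldType.
Implicit Types x y z : units F.

Definition units_one : units F := Units (oner_neq0 F).
Definition units_mul x y : units F := Units (mulf_neq0 (units_neq0 x) (units_neq0 y)).
Definition units_inv x : units F := Units (invr_neq0 (units_neq0 x)).

Lemma units_mulA : associative units_mul.
Proof. by move=> x y z; apply: val_inj; exact: mulrA. Qed.
Lemma units_mulC : commutative units_mul.
Proof. by move=> x y; apply: val_inj; exact: mulrC. Qed.
Lemma units_mul1 : left_id units_one units_mul.
Proof. by move=> x; apply: val_inj; exact: mul1r. Qed.
Lemma units_mulV : left_inverse units_one units_inv units_mul.
Proof. by move=> x; apply: val_inj; apply: mulVf; exact: units_neq0. Qed.

HB.instance Definition _ := GRing.isZmodule.Build (units F)
  units_mulA units_mulC units_mul1 units_mulV.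

End UnitsZmod.

Section K2.
Variable F : fieldType.

(* As [y] is a unit, y = 1 - x forces x <> 1. *)
Inductive steinberg_relation : tensor (units F) (units F) -> Prop :=
| SteinbergRelation (x y : units F) :
    val y = 1 - val x -> steinberg_relation (tens y x).

Definition K2 : zmodType := quotient_by steinberg_relation.

Definition symbol (x y : units F) : K2 :=
  quotient_class steinberg_relation (tens x y).

End K2.

Record seed := Seed {
  indices : finType;
  frozen : {set indices};
  eps : indices -> indices -> rat;
  mult : indices -> nat;
  eps_int : forall i j, ~~ ((i \in frozen) && (j \in frozen)) ->
    eps i j \is a Num.int;
  mult_gt0 : forall i, (0 < mult i)%N;
  mult_gcd : \big[gcdn/0%N]_i mult i = 1%N;
  eps_skew : forall i j, eps i j / (mult j)%:R = - (eps j i / (mult i)%:R)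
}.

Section Mutation.
Variables (s : seed) (k : indices s).

Definition mutate_eps (i j : indices s) : rat :=
  if (k == i) || (k == j) then - eps i j
  else if eps i k * eps k j <= 0 then eps i j
  else eps i j + `|eps i k| * eps k j.

Lemma mutate_eps_int (nfk : k \notin frozen s) i j :
  ~~ ((i \in frozen s) && (j \in frozen s)) -> mutate_eps i j \is a Num.int.
Proof.
move=> nfij; rewrite /mutate_eps; case: ifP => _; first by rewrite rpredN eps_int.
case: ifP => _; first exact: eps_int.
have ik : eps i k \is a Num.int by apply: eps_int; rewrite (negbTE nfk) andbF.
have kj : eps k j \is a Num.int by apply: eps_int; rewrite (negbTE nfk).
by rewrite rpredD ?eps_int // rpredM //; case: ler0P; rewrite ?rpredN.
Qed.

Lemma mutate_eps_skew i j :
  mutate_eps i j / (mult j)%:R = - (mutate_eps j i / (mult i)%:R).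
Proof.
have E (a b : indices s) : eps a b = - (eps b a / (mult a)%:R) * (mult b)%:R.
  by rewrite -eps_skew divfK // pnatr_eq0 -lt0n mult_gt0.
have P (a : indices s) : 0 < (mult a)%:R :> rat by rewrite ltr0n mult_gt0.
have N (a : indices s) : (mult a)%:R != 0 :> rat by rewrite gt_eqF.
rewrite /mutate_eps [(k == j) || _]orbC; case: ifP => _.
  by rewrite !mulNr eps_skew.
have -> : (eps j k * eps k i <= 0) = (eps i k * eps k j <= 0).
  rewrite (E j k) (E k i).
  have -> : - (eps k j / (mult j)%:R) * (mult k)%:R *
      (- (eps i k / (mult k)%:R) * (mult i)%:R) =
      (eps i k * eps k j) * ((mult i)%:R / (mult j)%:R).
    by field; rewrite !N.
  by rewrite pmulr_lle0 // divr_gt0.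
case: ifP => [_|]; first exact: eps_skew.
move=> /negbT; rewrite -ltNge => pos.
rewrite !mulrDl opprD eps_skew; congr (_ + _).
have [/andP[p q]|/andP[p q]] :
    (0 < eps i k) && (0 < eps k j) \/ (eps i k < 0) && (eps k j < 0).
  case: (ltgtP 0 (eps i k)) pos => [p|p|<-]; rewrite ?mul0r ?ltxx //.
    by rewrite pmulr_rgt0 // => ->; left.
  by rewrite nmulr_rgt0 // => ->; right.
- have r : eps j k < 0 by rewrite (E j k) mulNr oppr_lt0 mulr_gt0 // divr_gt0.
  by rewrite (gtr0_norm p) (ltr0_norm r) (E j k) (E k i); field; rewrite !N.
- have r : 0 < eps j k.
    by rewrite (E j k) mulNr oppr_gt0 !pmulr_llt0 // invr_gt0.
  by rewrite (ltr0_norm p) (gtr0_norm r) (E j k) (E k i); field; rewrite !N.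
Qed.

End Mutation.

Definition mutate (s : seed) (k : indices s) (nfk : k \notin frozen s) : seed :=
  @Seed (indices s) (frozen s) (mutate_eps k) (@mult s)
    (mutate_eps_int nfk) (@mult_gt0 s) (mult_gcd s) (mutate_eps_skew k).

Definition seed_isomorphism (s s' : seed) (f : indices s -> indices s') : Prop :=
  [/\ bijective f,
      forall i, (f i \in frozen s') = (i \in frozen s),
      forall i j, eps (f i) (f j) = eps i j
    & forall i, mult (f i) = mult i].

(* The rational functions on the seed torus: rational functions over rat in
   variables indexed by [indices s], this set being enumerated. *)
Definition torus_field (s : seed) : fieldType := {fraction {mpoly rat[#|indices s|]}}.

Definition coord (s : seed) (i : indices s) : torus_field s :=
  tofrac ('X_(enum_rank i) : {mpoly rat[#|indices s|]}).

Lemma coord_neq0 s (i : indices s) : coord i != 0.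
Proof.
rewrite tofrac_eq0; apply/negP => /eqP /(congr1 (fun p => p@_(U_(enum_rank i))%MM)).
by rewrite mcoeffX eqxx mcoeff0 => /eqP; rewrite oner_eq0.
Qed.

(* Pullbacks of rational functions go from the field of the target torus to the
   field of the source torus.  The exponents are integers because k is not
   frozen, so that [Num.floor] is here the identification of an integral
   rational number with an element of int. *)
Definition is_mutation_pullback (s : seed) (k : indices s) (nfk : k \notin frozen s)
    (phi : {rmorphism torus_field (mutate nfk) -> torus_field s}) : Prop :=
  coord k * phi (@coord (mutate nfk) k) =
      \prod_(j : indices s | 0 < eps k j) coord j ^ Num.floor (eps k j)
    + \prod_(j : indices s | eps k j < 0) coord j ^ Num.floor (- eps k j)
  /\ forall i : indices s, i != k -> phi (@coord (mutate nfk) i) = coord i.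

Definition is_isomorphism_pullback (s s' : seed) (f : indices s -> indices s')
    (phi : {rmorphism torus_field s' -> torus_field s}) : Prop :=
  forall i, phi (coord (f i)) = coord i.

(* [cluster_transformation phi], for phi : Q(A_s') -> Q(A_s), says that phi is
   the pullback along a cluster transformation A_s -> A_s'. *)
Inductive cluster_transformation : forall s s' : seed,
    {rmorphism torus_field s' -> torus_field s} -> Prop :=
| cluster_mutation s (k : indices s) (nfk : k \notin frozen s) phi :
    is_mutation_pullback (nfk := nfk) phi ->
    @cluster_transformation s (mutate nfk) phi
| cluster_isomorphism s s' (f : indices s -> indices s') phi :
    seed_isomorphism f -> is_isomorphism_pullback f phi ->
    @cluster_transformation s s' phi
| cluster_comp s s' s''
    (phi : {rmorphism torus_field s' -> torus_field s})
    (psi : {rmorphism torus_field s'' -> torus_field s'}) :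
    cluster_transformation phi -> cluster_transformation psi ->
    @cluster_transformation s s'' (phi \o psi).

(* The coordinates of a seed s' equivalent to s, as elements of Q(A_s). *)
Definition cluster_coordinates (s s' : seed)
    (a : indices s' -> units (torus_field s)) : Prop :=
  exists2 phi : {rmorphism torus_field s' -> torus_field s},
    cluster_transformation phi & forall i, val (a i) = phi (coord i).

Definition eps_tilde (s : seed) (i j : indices s) : rat := (mult i)%:R * eps i j.

Section W.
Variables (s : seed) (F : fieldType) (a : indices s -> units F).

(* The coefficients indexed by two frozen elements may be non-integral
   rationals, in which case the sum lives in K_2(F) (x) Q. *)
Definition W_rat : tensor (K2 F) rat :=
  \sum_(i : indices s) \sum_(j : indices s) tens (symbol (a i) (a j)) (eps_tilde i j).

Definition eps_tilde_integral : Prop :=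
  forall i j : indices s, eps_tilde i j \is a Num.int.

(* Meaningful when [eps_tilde_integral] holds. *)
Definition W_int : K2 F :=
  \sum_(i : indices s) \sum_(j : indices s)
    symbol (a i) (a j) *~ Num.floor (eps_tilde i j).

End W.

Section FractionLift.
Variables (R : idomainType) (F : fieldType) (f : {rmorphism R -> F}).
Variable f_eq0 : forall x, f x = 0 -> x = 0.

Lemma fractionE (x : {fraction R}) :
  exists2 nd : R * R, nd.2 != 0 & x * tofrac nd.2 = tofrac nd.1.
Proof.
rewrite -[x]reprK; set r := repr x.
exists (frac r); first exact: denom_ratioP.
unlock tofrac; rewrite -[LHS]FracField.pi_mul /FracField.mulf.
rewrite !numden_Ratio ?oner_neq0 // mulr1; apply/eqmodP => /=.
by rewrite /FracField.equivf !numden_Ratio ?oner_neq0 ?denom_ratioP // mulr1 mulrC.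
Qed.

Lemma fraction_lift_exists :
  exists phi : {rmorphism {fraction R} -> F}, forall x, phi (tofrac x) = f x.
Proof.
have fN0 x : x != 0 -> f x != 0.
  by apply: contra_neq => /f_eq0.
have ex x : {y | forall n d, d != 0 -> x * tofrac d = tofrac n -> y = f n / f d}.
  apply: cid; have [[n d] /= d0 E] := fractionE x; exists (f n / f d).
  move=> n' d' d'0 E'; apply/eqP; rewrite eqr_div ?fN0 // -!rmorphM.
  apply/eqP; congr (f _); apply/eqP; rewrite -tofrac_eq !tofracM -E -E'.
  by apply/eqP; ring.
pose g x := sval (ex x).
have gE x n d : d != 0 -> x * tofrac d = tofrac n -> g x = f n / f d.
  by move=> d0 E; rewrite /g; case: (ex x) => /= y; apply.
have gt x : g (tofrac x) = f x.
  by rewrite (gE _ x 1) ?oner_neq0 // ?rmorph1 ?mulr1 // divr1.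
have gB : zmod_morphism g.
  move=> x y; have [[n d] /= d0 E] := fractionE x.
  have [[m e] /= e0 E'] := fractionE y.
  rewrite (gE _ _ _ d0 E) (gE _ _ _ e0 E').
  rewrite (gE _ (n * e - m * d) (d * e)) ?mulf_neq0 //.
    by rewrite rmorphB !rmorphM; field; rewrite !fN0.
  by rewrite tofracB !tofracM -E -E'; ring.
have gM : monoid_morphism g.
  split; first by rewrite -tofrac1 gt rmorph1.
  move=> x y; have [[n d] /= d0 E] := fractionE x.
  have [[m e] /= e0 E'] := fractionE y.
  rewrite (gE _ _ _ d0 E) (gE _ _ _ e0 E').
  rewrite (gE _ (n * m) (d * e)) ?mulf_neq0 //.
    by rewrite !rmorphM; field; rewrite !fN0.
  by rewrite !tofracM -E -E'; ring.
pose Bg := GRing.isZmodMorphism.Build _ _ g gB.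
pose Mg := GRing.isMonoidMorphism.Build _ _ g gM.
pose phi : {rmorphism {fraction R} -> F} := HB.pack g Bg Mg.
by exists phi => x; exact: gt.
Qed.

End FractionLift.

Section MpolyEval.
Variables (n : nat) (F : fieldType) (c : {rmorphism rat -> F}) (h : 'I_n -> F).

Definition mpoly_eval : {mpoly rat[n]} -> F := mmap c h.

HB.instance Definition _ := GRing.RMorphism.on mpoly_eval.

Lemma mpoly_evalX i : mpoly_eval 'X_i = h i.
Proof. by rewrite /mpoly_eval mmapX mmap1U. Qed.

Lemma mpoly_evalC a : mpoly_eval a%:MP = c a.
Proof. by rewrite /mpoly_eval mmapC. Qed.

End MpolyEval.

(* [ev p] times [tofrac D] comes from R', and [ev'] then gives back p: this
   forces the kernel of [ev] to be trivial. *)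
Section InverseUpToFractions.
Variables (R R' : idomainType).
Variables (ev : {rmorphism R -> {fraction R'}}) (ev' : {rmorphism R' -> {fraction R}}).

Definition fraction_retract (p : R) := exists D q : R',
  [/\ ev' D != 0, tofrac D * ev p = tofrac q & ev' q = ev' D * tofrac p].

Lemma fraction_retractD p p' :
  fraction_retract p -> fraction_retract p' -> fraction_retract (p + p').
Proof.
move=> [D [q [D0 E1 E2]]] [D' [q' [D'0 E1' E2']]].
exists (D * D'), (q * D' + q' * D); split; first by rewrite rmorphM mulf_neq0.
  by rewrite rmorphD tofracD !tofracM -E1 -E1'; ring.
by rewrite tofracD rmorphD !rmorphM E2 E2'; ring.
Qed.

Lemma fraction_retractM p p' :
  fraction_retract p -> fraction_retract p' -> fraction_retract (p * p').
Proof.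
move=> [D [q [D0 E1 E2]]] [D' [q' [D'0 E1' E2']]].
exists (D * D'), (q * q'); split; first by rewrite rmorphM mulf_neq0.
  by rewrite rmorphM !tofracM -E1 -E1'; ring.
by rewrite tofracM !rmorphM E2 E2'; ring.
Qed.

Lemma fraction_retract_eq0 p : fraction_retract p -> ev p = 0 -> p = 0.
Proof.
move=> [D [q [D0 E1 E2]]] p0; move: E1; rewrite p0 mulr0 => /esym/eqP.
rewrite tofrac_eq0 => /eqP q0; move/eqP: E2; rewrite q0 rmorph0 eq_sym mulf_eq0.
by rewrite (negPf D0) tofrac_eq0 => /eqP.
Qed.

End InverseUpToFractions.

Definition fraction_const n (a : rat) : {fraction {mpoly rat[n]}} := tofrac a%:MP.

HB.instance Definition _ n := GRing.RMorphism.copy (@fraction_const n)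
  (@tofrac _ \o @mpolyC n rat).

Section EvalInjective.
Variables n m : nat.
Variables (ev : {rmorphism {mpoly rat[n]} -> {fraction {mpoly rat[m]}}})
  (ev' : {rmorphism {mpoly rat[m]} -> {fraction {mpoly rat[n]}}}).
Variable evC : forall a, ev a%:MP = fraction_const m a.
Variable evC' : forall a, ev' a%:MP = fraction_const n a.

Lemma mpoly_eval_eq0 : (forall i, fraction_retract ev ev' 'X_i) ->
  forall p, ev p = 0 -> p = 0.
Proof.
move=> goodX.
have goodC a : fraction_retract ev ev' a%:MP.
  exists 1, a%:MP; split; first by rewrite rmorph1 oner_neq0.
    by rewrite tofrac1 mul1r evC.
  by rewrite rmorph1 mul1r evC'.
have good1 : fraction_retract ev ev' 1 by rewrite -mpolyC1.
have goodXm (mm : 'X_{1..n}) : fraction_retract ev ev' 'X_[mm].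
  rewrite mpolyXE_id; apply: big_ind => //; first exact: fraction_retractM.
  move=> i _; elim: (mm i) => [|k IH]; first by rewrite expr0.
  by rewrite exprS; apply: fraction_retractM.
move=> p; apply: fraction_retract_eq0.
elim/mpolyind: p => [|a mm p _ _ IH]; first by rewrite -mpolyC0.
by apply: fraction_retractD => //; rewrite -mul_mpolyC; apply: fraction_retractM.
Qed.

End EvalInjective.

Lemma isomorphism_pullback_exists (s s' : seed) (f : indices s -> indices s') :
  seed_isomorphism f -> exists phi, @is_isomorphism_pullback s s' f phi.
Proof.
case=> -[g fK gK] _ _ _.
pose h (i : 'I_#|indices s'|) : torus_field s := coord (g (enum_val i)).
pose h' (i : 'I_#|indices s|) : torus_field s' := coord (f (enum_val i)).
have inj : forall p, mpoly_eval (@fraction_const _) h p = 0 -> p = 0.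
  apply: (@mpoly_eval_eq0 _ _ (mpoly_eval (@fraction_const _) h)
    (mpoly_eval (@fraction_const _) h')) => [a|a|i]; try exact: mpoly_evalC.
  exists 1, 'X_(enum_rank (g (enum_val i))).
  rewrite rmorph1 oner_neq0 tofrac1 !mul1r /= !mpoly_evalX.
  by rewrite /h /h' enum_rankK gK /coord enum_valK.
have [phi E] := fraction_lift_exists inj.
exists phi => i; rewrite /coord E /= mpoly_evalX /h enum_rankK fK //.
Qed.

Lemma mutation_pullback_exists (s : seed) (k : indices s) (nfk : k \notin frozen s) :
  exists phi, @is_mutation_pullback s k nfk phi.
Proof.
pose n := #|indices s|.
pose x (i : indices s) : {mpoly rat[n]} := 'X_(enum_rank i).
pose c : {mpoly rat[n]} := \prod_(j : indices s | 0 < eps k j) x j ^+ `|Num.floor (eps k j)|%N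
  + \prod_(j : indices s | eps k j < 0) x j ^+ `|Num.floor (- eps k j)|%N.
pose h (i : 'I_n) : torus_field s :=
  if i == enum_rank k then tofrac c / coord k else tofrac 'X_i.
have epskk : eps k k = 0.
  have /eqP := eps_skew k k; rewrite -addr_eq0 -mulr2n mulrn_eq0 /= mulf_eq0.
  by rewrite invr_eq0 pnatr_eq0 -[(mult k == 0)%N]negbK -lt0n mult_gt0 orbF => /eqP.
have hx j : j != k -> h (enum_rank j) = tofrac (x j).
  by move=> jk; rewrite /h (inj_eq enum_rank_inj) (negPf jk).
have evc : mpoly_eval (@fraction_const n) h c = tofrac c.
  rewrite /c !rmorphD !rmorph_prod; congr (_ + _); apply: eq_bigr => j ek;
  rewrite !rmorphXn /= mpoly_evalX hx //; apply: contraTneq ek => ->;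
  by rewrite epskk ltxx.
have c0 : c != 0.
  apply/eqP => /(congr1 (meval (fun=> 1 : rat))).
  rewrite /c rmorphD !rmorph_prod rmorph0 !big1 => [//|j _|j _];
  by rewrite rmorphXn /= mevalXU expr1n.
have tc0 : tofrac c != 0 by rewrite tofrac_eq0.
have ck0 : coord k != 0 := coord_neq0 k.
have inj : forall p, mpoly_eval (@fraction_const n) h p = 0 -> p = 0.
  pose ev := mpoly_eval (@fraction_const n) h.
  apply: (@mpoly_eval_eq0 _ _ ev ev) => [a|a|i]; try exact: mpoly_evalC.
  have [->|ik] := eqVneq i (enum_rank k).
    exists (x k), c; rewrite /= /ev evc !mpoly_evalX /h eqxx; split.
    - exact: (mulf_neq0 tc0 (invr_neq0 ck0)).
    - exact: (etrans (mulrC _ _) (divfK ck0 _)).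
    - exact: (esym (divfK ck0 _)).
  exists 1, 'X_i; rewrite rmorph1 oner_neq0 tofrac1 !mul1r /= /ev mpoly_evalX.
  by rewrite /h (negPf ik).
have fl (e : rat) (y : torus_field s) : 0 < e ->
    y ^+ `|Num.floor e|%N = y ^ Num.floor e.
  by move=> e0; rewrite exprnP gez0_abs // floor_ge0 ltW.
have [phi E] := fraction_lift_exists inj.
exists phi; split=> [|i ik]; last first.
  by rewrite /coord E /= mpoly_evalX hx.
rewrite /coord E /= mpoly_evalX /h eqxx mulrC divfK // /c tofracD !rmorph_prod.
congr (_ + _); apply: eq_bigr => j ek; rewrite /= tofracXn;
by apply: fl; rewrite ?oppr_gt0.
Qed.

(* Main.v *)
Require Import Defs.
From mathcomp Require Import all_boot all_order all_algebra.
From mathcomp Require Import ring zify.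

(** Every cluster transformation is a composite of mutations and seed
isomorphisms, and isomorphisms merely reindex the sum, so everything rests on
one mutation at k, where only A_k and the entries of eps change.  All the
changes of entries are integers, even between frozen indices, so they can be
moved into the first argument of each term, and the difference of the two sums
becomes the image of an element of K_2.

Put c_j = eps_kj, p_j = max(c_j, 0), n_j = max(-c_j, 0), and let
P = prod A_j^p_j and N = prod A_j^n_j be the two monomials of the exchange
relation A_k A'_k = P + N, so that P / N = prod A_j^c_j.
Since eps_tilde is skew-symmetric and so are symbols, the terms involving k
add up to 2 d_k {A_k, P/N} before the mutation and to -2 d_k {A'_k, P/N}
after it ([symbol_sum_split]).  The other entries of eps_tilde change by
d_k (n_i p_j - p_i n_j) ([eps_tilde_mutate]), so the other terms change by
d_k ({N, P} - {P, N}).  Invariance thus amounts to the identity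
      2 {A_k A'_k, P/N} = {N, P} - {P, N}                 ([exchange_symbols]).
Write A_k A'_k = N (1 + P/N).  The Steinberg relation makes {1 + x, -x} vanish,
hence {1 + x, x} is {1 + x, -1} and is killed by 2; what remains is
2 {N, P/N} = 2 {N, P} - 2 {N, N} = 2 {N, P}, where 2 {N, N} = 0 by
skew-symmetry.

The sum with values in the tensor product with the rationals and the sum with
values in K_2 itself are both instances of a sum of B({A_i, A_j}, eps_tilde_ij)
for a suitable pairing B ([coefficient_pairing]), and are treated at once.  The
induction is done for the images of the coordinates in an arbitrary field, which
makes the composition of transformations immediate. *)

Set Implicit Arguments.
Unset Strict Implicit.
Unset Printing Implicit Defensive.

Import Order.TTheory GRing.Theory Num.Theory.

(** * Symbols in the group K_2 of a field *)

Section QuotientClass.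
Local Open Scope ring_scope.
Variables (V : zmodType) (P : V -> Prop).

Lemma quotient_class0 : quotient_class P 0 = 0.
Proof. by rewrite -(subrr 0) quotient_classB subrr. Qed.

Lemma quotient_classD : {morph quotient_class P : x y / x + y}.
Proof.
move=> x y; rewrite -{1}[y]opprK -[- y]sub0r.
by rewrite !quotient_classB quotient_class0 sub0r opprK.
Qed.

End QuotientClass.

Section Symbols.
Local Open Scope ring_scope.
Variable F : fieldType.
Implicit Types x y z : units F.

Lemma symbolDl x y z : symbol (x + y) z = symbol x z + symbol y z.
Proof. exact: etrans (congr1 _ (tensDl _ _ _)) (quotient_classD _ _ _). Qed.

Lemma symbolDr x y z : symbol x (y + z) = symbol x y + symbol x z.
Proof. exact: etrans (congr1 _ (tensDr _ _ _)) (quotient_classD _ _ _). Qed.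

Lemma symbol0l y : symbol 0 y = 0.
Proof. by apply: (addrI (symbol 0 y)); rewrite -symbolDl !addr0. Qed.

Lemma symbol0r x : symbol x 0 = 0.
Proof. by apply: (addrI (symbol x 0)); rewrite -symbolDr !addr0. Qed.

Lemma symbolNl x y : symbol (- x) y = - symbol x y.
Proof. by apply/eqP; rewrite -addr_eq0 -symbolDl addNr symbol0l. Qed.

Lemma symbolNr x y : symbol x (- y) = - symbol x y.
Proof. by apply/eqP; rewrite -addr_eq0 -symbolDr addNr symbol0r. Qed.

Lemma symbolMzl x y n : symbol (x *~ n) y = symbol x y *~ n.
Proof.
have nat m : symbol (x *+ m) y = symbol x y *+ m.
  by elim: m => [|m IH]; rewrite ?mulr0n ?symbol0l // !mulrS symbolDl IH.
by case: n => m; rewrite ?NegzE ?mulrNz ?symbolNl -!pmulrn nat.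
Qed.

Lemma symbolMzr x y n : symbol x (y *~ n) = symbol x y *~ n.
Proof.
have nat m : symbol x (y *+ m) = symbol x y *+ m.
  by elim: m => [|m IH]; rewrite ?mulr0n ?symbol0r // !mulrS symbolDr IH.
by case: n => m; rewrite ?NegzE ?mulrNz ?symbolNr -!pmulrn nat.
Qed.

Lemma symbol_suml (I : finType) (a : I -> units F) (n : I -> int) y :
  symbol (\sum_i a i *~ n i) y = \sum_i symbol (a i) y *~ n i.
Proof.
rewrite (big_morph (fun x => symbol x y) (fun x z => symbolDl x z y) (symbol0l y)).
by apply: eq_bigr => i _; exact: symbolMzl.
Qed.

Lemma symbol_sumr (I : finType) x (a : I -> units F) (n : I -> int) :
  symbol x (\sum_i a i *~ n i) = \sum_i symbol x (a i) *~ n i.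
Proof.
rewrite (big_morph (fun y => symbol x y) (symbolDr x) (symbol0r x)).
by apply: eq_bigr => i _; exact: symbolMzr.
Qed.

Lemma symbol_sum (I : finType) (a : I -> units F) (m n : I -> int) :
  symbol (\sum_i a i *~ m i) (\sum_j a j *~ n j)
  = \sum_i \sum_j symbol (a i) (a j) *~ (m i * n j).
Proof.
rewrite symbol_suml; apply: eq_bigr => i _; rewrite symbol_sumr mulrz_suml.
by apply: eq_bigr => j _; rewrite mulrC mulrzA.
Qed.

Lemma symbol_steinberg x y : val y = 1 - val x -> symbol y x = 0.
Proof.
move=> E; rewrite -(quotient_class0 (@steinberg_relation F)).
apply/quotient_class_eq; rewrite subr0; apply: gen_subgroup_mem.
exact: SteinbergRelation.
Qed.

(** The classical relation {x, -x} = 0, from -x = (1 - x) / (1 - 1/x): both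
{x, 1 - x} and {1/x, 1 - 1/x} are Steinberg symbols. *)
Lemma symbol_opp x y : val y = - val x -> symbol x y = 0.
Proof.
move=> Ey; have [x1|x1] := eqVneq (val x) 1.
  have -> : x = 0 by apply: val_inj.
  exact: symbol0l.
have x0 := units_neq0 x.
have u0 : 1 - val x != 0 by rewrite subr_eq0 eq_sym.
have v0 : 1 - (val x)^-1 != 0 by rewrite subr_eq0 eq_sym invr_eq1.
pose u := Units u0; pose v := Units v0.
have -> : y = u - v.
  apply: val_inj; rewrite Ey; change (- val x = (1 - val x) / (1 - (val x)^-1)).
  by field; rewrite x0 subr_eq0 x1.
have cK (t : F) : t = 1 - (1 - t) by rewrite opprB addrC subrK.
have xu : symbol x u = 0 by apply: symbol_steinberg; exact: cK.
have xv : symbol (- x) v = 0 by apply: symbol_steinberg; exact: cK.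
by rewrite symbolDr symbolNr -symbolNl xu xv addr0.
Qed.

(** Expand {xy, -xy} = 0, writing -xy as (-x) y in front of x and as x (-y) in
front of y. *)
Lemma symbolC x y : symbol y x = - symbol x y.
Proof.
have N0 z : - val z != 0 by rewrite oppr_eq0 units_neq0.
pose opp z := Units (N0 z).
have oppP z : symbol z (opp z) = 0 by exact: symbol_opp.
have opp_addl : opp (x + y) = opp x + y by apply: val_inj; rewrite /= mulNr.
have opp_addr : opp (x + y) = x + opp y by apply: val_inj; rewrite /= mulrN.
have := oppP (x + y); rewrite symbolDl {1}opp_addl opp_addr !symbolDr !oppP.
by rewrite add0r addr0 addrC => /eqP; rewrite addr_eq0 => /eqP.
Qed.

Lemma symbolxx_double x : symbol x x *+ 2 = 0.
Proof. by rewrite mulr2n {1}symbolC addNr. Qed.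

(** {1 + x, -x} is a Steinberg symbol, so {1 + x, x} = {1 + x, -1}, and
-1 has order two. *)
Lemma symbol_add1_double x y : val y = 1 + val x -> symbol y x *+ 2 = 0.
Proof.
move=> Ey; have N0 : - val x != 0 by rewrite oppr_eq0 units_neq0.
have N1 : - 1 != 0 :> F by rewrite oppr_eq0 oner_neq0.
have -> : x = Units N0 + Units N1 by apply: val_inj; rewrite /= mulrN1 opprK.
rewrite symbolDr symbol_steinberg ?add0r; last by rewrite Ey /= opprK.
rewrite mulr2n -symbolDr.
have -> : Units N1 + Units N1 = 0 by apply: val_inj; rewrite /= mulrN1 opprK.
exact: symbol0r.
Qed.

End Symbols.

(** * Double sums of symbols under a mutation *)

Section SymbolSums.
Local Open Scope ring_scope.

Definition pos_part (z : int) : int := Num.max z 0.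
Definition neg_part (z : int) : int := Num.max (- z) 0.

Lemma pos_partB_neg_part z : pos_part z - neg_part z = z.
Proof. by rewrite /pos_part /neg_part; lia. Qed.

(** The correction term of the mutation rule, read on row k only: x and y stand
for eps_ki and eps_kj, and eps_ik has the sign opposite to eps_ki, so that the
correction occurs when x and y have opposite signs. *)
Lemma abs_mul_opposite (x y : int) :
  (if 0 <= x * y then 0 else `|x| * y)
  = neg_part x * pos_part y - pos_part x * neg_part y.
Proof.
rewrite /neg_part /pos_part.
by case: ifP; case: (lerP 0 x) => x0; nia.
Qed.

(** Additivity in the second argument is only required when one summand is an
integer, so that taking the integer part of the coefficient qualifies.  This
suffices because a mutation changes coefficients by integers. *)
Definition coefficient_pairing (G M : zmodType) (B : G -> rat -> M) : Prop :=
  (forall q, {morph B^~ q : x y / x + y}) /\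
  (forall x q r, r \is a Num.int -> B x (q + r) = B x q + B x r).

Variables (F : fieldType) (M : zmodType) (B : K2 F -> rat -> M).
Hypothesis pairingB : coefficient_pairing B.

Lemma pairingDl q : {morph B^~ q : x y / x + y}.
Proof. by case: pairingB. Qed.

Lemma pairingDr x q r : r \is a Num.int -> B x (q + r) = B x q + B x r.
Proof. by case: pairingB => _; exact. Qed.

Lemma pairing0l q : B 0 q = 0.
Proof. by apply: (addrI (B 0 q)); rewrite -pairingDl !addr0. Qed.

Lemma pairing0r x : B x 0 = 0.
Proof. by apply: (addrI (B x 0)); rewrite -pairingDr ?rpred0 // !addr0. Qed.

Lemma pairing_sum (J : finType) (x : J -> K2 F) q :
  B (\sum_j x j) q = \sum_j B (x j) q.
Proof. exact: (big_morph (B^~ q) (pairingDl q) (pairing0l q)). Qed.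

Lemma pairing_int x (m : int) : B x m%:~R = B (x *~ m) 1.
Proof.
have nat n y : B y n%:R = B (y *+ n) 1.
  elim: n => [|n IH]; first by rewrite pairing0r mulr0n pairing0l.
  by rewrite mulrSr pairingDr ?rpred1 // IH -pairingDl -mulrSr.
case: m => n; first exact: nat.
rewrite NegzE !mulrNz -!pmulrn; apply: (addrI (B x n.+1%:R)).
rewrite -pairingDr ?rpredN ?rpred_nat // subrr pairing0r nat -pairingDl.
by rewrite subrr pairing0l.
Qed.

Variables (I : finType) (k : I).
Implicit Types (a : I -> units F) (c : I -> int) (e : I -> I -> rat).

(** The row and the column of k contribute the same amount, their coefficients
and their symbols being both opposite. *)
Lemma symbol_sum_split a c (d : int) e :
    c k = 0 -> (forall j, e k j = (d * c j)%:~R) ->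
    (forall i, e i k = (- (d * c i))%:~R) ->
  \sum_i \sum_j B (symbol (a i) (a j)) (e i j) =
    \sum_(i | i != k) \sum_(j | j != k) B (symbol (a i) (a j)) (e i j)
    + B (symbol (a k) (\sum_j a j *~ c j) *~ (2 * d)) 1.
Proof.
move=> ck ekj eik.
have row : \sum_j B (symbol (a k) (a j)) (e k j) =
    B (symbol (a k) (\sum_j a j *~ c j) *~ d) 1.
  rewrite symbol_sumr mulrz_suml pairing_sum; apply: eq_bigr => j _.
  by rewrite ekj pairing_int mulrC mulrzA.
have col : \sum_(i | i != k) B (symbol (a i) (a k)) (e i k) =
    B (symbol (a k) (\sum_j a j *~ c j) *~ d) 1.
  transitivity (\sum_i B (symbol (a i) (a k)) (e i k)).
    by rewrite [RHS](bigD1 k) //= eik ck mulr0 oppr0 pairing0r add0r.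
  rewrite -row; apply: eq_bigr => i _.
  by rewrite eik ekj !pairing_int symbolC mulNrz mulrNz opprK.
rewrite (bigD1 k) //= row.
under eq_bigr => i _ do rewrite (bigD1 k) //=.
by rewrite big_split /= col addrA -pairingDl -mulrzDr mulrDl mul1r addrC.
Qed.

(** The exchange relation reads xy/N = 1 + P/N, so the symbol of xy/N with P/N
is killed by 2, and only the symbol of N with P/N remains.  In the additive
notation for units, P - N is the quotient P/N. *)
Lemma exchange_symbols (P N x y : units F) :
  val x * val y = val P + val N ->
  symbol x (P - N) *+ 2 + symbol y (P - N) *+ 2 = symbol N P - symbol P N.
Proof.
move=> E; rewrite -mulrnDl -symbolDl.
rewrite -[x + y](subrK N) symbolDl mulrnDl symbol_add1_double ?add0r.
  by rewrite symbolDr symbolNr mulrnBl symbolxx_double subr0 [symbol P N]symbolC opprK.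
change (val x * val y / val N = 1 + val P / val N).
by rewrite E mulrDl divff ?units_neq0 // addrC.
Qed.

(** The mutation formula in coordinates: the terms of k are gathered by
[symbol_sum_split] and the others shift by a multiple of {N, P} - {P, N};
[exchange_symbols] says that the two effects cancel. *)
Lemma symbol_sum_mutation a a' c (d : int) e e' :
    c k = 0 ->
    (forall j, e k j = (d * c j)%:~R) ->
    (forall i, e i k = (- (d * c i))%:~R) ->
    (forall j, e' k j = - e k j) -> (forall i, e' i k = - e i k) ->
    (forall i j, i != k -> j != k -> e' i j = e i j +
      (d * (neg_part (c i) * pos_part (c j) - pos_part (c i) * neg_part (c j)))%:~R) ->
    (forall i, i != k -> a' i = a i) ->
    val (a k) * val (a' k) =
      val (\sum_j a j *~ pos_part (c j)) + val (\sum_j a j *~ neg_part (c j)) ->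
  \sum_i \sum_j B (symbol (a' i) (a' j)) (e' i j) =
  \sum_i \sum_j B (symbol (a i) (a j)) (e i j).
Proof.
move=> ck ekj eik e'kj e'ik e'ij a'i; set P := \sum_j _; set N := \sum_j _ => exch.
have XE : \sum_j a j *~ c j = P - N.
  rewrite /P /N -sumrB; apply: eq_bigr => j _.
  by rewrite -mulrzBr pos_partB_neg_part.
have X'E : \sum_j a' j *~ c j = P - N.
  rewrite -XE; apply: eq_bigr => j _; have [->|/a'i-> //] := eqVneq j k.
  by rewrite ck !mulr0z.
rewrite (symbol_sum_split a ck ekj eik) XE.
rewrite (@symbol_sum_split a' c (- d)) //; first last.
- by move=> i; rewrite e'ik eik mulNr opprK mulrNz opprK.
- by move=> j; rewrite e'kj ekj mulNr mulrNz.
rewrite X'E.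
(* As c k = 0, the correction r vanishes on the row and column of k, and its sum
   may be taken over all indices, where it factors through P and N. *)
pose r i j := neg_part (c i) * pos_part (c j) - pos_part (c i) * neg_part (c j).
have rk i : r i k = 0 by rewrite /r ck /pos_part /neg_part oppr0 maxxx !mulr0 subrr.
have kr j : r k j = 0 by rewrite /r ck /pos_part /neg_part oppr0 maxxx !mul0r subrr.
have inner : \sum_(i | i != k) \sum_(j | j != k) B (symbol (a' i) (a' j)) (e' i j) =
    \sum_(i | i != k) \sum_(j | j != k) B (symbol (a i) (a j)) (e i j)
    + B ((symbol N P - symbol P N) *~ d) 1.
  transitivity (\sum_(i | i != k) \sum_(j | j != k)
      (B (symbol (a i) (a j)) (e i j) + B (symbol (a i) (a j) *~ r i j *~ d) 1)).
    apply: eq_bigr => i ik; apply: eq_bigr => j jk; rewrite !a'i // e'ij //.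
    by rewrite pairingDr ?rpred_int // pairing_int -mulrzA [r i j * d]mulrC.
  under eq_bigr => i _ do rewrite big_split /=.
  rewrite big_split /=; congr (_ + _).
  rewrite /N /P !symbol_sum -sumrB mulrz_suml pairing_sum [RHS](bigD1 k) //=.
  rewrite -sumrB mulrz_suml pairing_sum.
  rewrite [X in X + _]big1 => [|j _]; last first.
    by rewrite -mulrzBr -/(r k j) kr mulr0z mul0rz pairing0l.
  rewrite add0r; apply: eq_bigr => i _.
  rewrite -sumrB mulrz_suml pairing_sum [RHS](bigD1 k) //=.
  rewrite -mulrzBr -/(r i k) rk mulr0z mul0rz pairing0l add0r.
  by apply: eq_bigr => j _; rewrite -mulrzBr.
rewrite inner -addrA; congr (_ + _); rewrite -pairingDl; congr (B _ 1).
rewrite -(exchange_symbols exch) !mulrzA mulrNz mulrzDl !mulrz_nat.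
by rewrite addrK.
Qed.

End SymbolSums.

(** * Invariance under cluster transformations *)

Section Invariance.
Local Open Scope ring_scope.

Lemma val_units_mulz (F : fieldType) (x : units F) (n : int) :
  val (x *~ n) = val x ^ n.
Proof.
have nat m : val (x *+ m) = val x ^+ m.
  by elim: m => [|m IH] //; rewrite mulrS exprS -IH.
case: n => m; first exact: nat.
by rewrite NegzE mulrNz -invr_expz -exprnP -nat.
Qed.

Lemma val_units_sum (F : fieldType) (I : finType) (a : I -> units F) (n : I -> int) :
  val (\sum_i a i *~ n i) = \prod_i val (a i) ^ n i.
Proof.
have valD : {morph (fun x : units F => val x) : x y / x + y >-> x * y} by [].
rewrite (big_morph _ valD (erefl : val (0 : units F) = 1)).
by apply: eq_bigr => i _; exact: val_units_mulz.
Qed.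

Definition W_pairing (s : seed) (F : fieldType) (M : zmodType)
    (B : K2 F -> rat -> M) (a : indices s -> units F) : M :=
  \sum_(i : indices s) \sum_(j : indices s) B (symbol (a i) (a j)) (eps_tilde i j).

Lemma eps_tilde_skew s (i j : indices s) : eps_tilde i j = - eps_tilde j i.
Proof.
have N (l : indices s) : (mult l)%:R != 0 :> rat by rewrite pnatr_eq0 -lt0n mult_gt0.
have := eps_skew i j; rewrite /eps_tilde => E.
rewrite -[eps i j](divfK (N j)) E mulNr mulrN; congr (- _).
by field; rewrite N.
Qed.

Lemma eps_diag s (i : indices s) : eps i i = 0.
Proof.
have := eps_tilde_skew i i; move/eqP; rewrite -addr_eq0 -mulr2n mulrn_eq0 /=.
by rewrite mulf_eq0 pnatr_eq0 -[(mult i == 0)%N]negbK -lt0n mult_gt0 => /eqP.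
Qed.

(** The rule for eps involves row i at k, which skew-symmetry turns into row k:
d_i eps_ik = - d_k eps_ki.  This is what makes the correction a function of the
single row c, with the common factor d_k. *)
Lemma eps_tilde_mutate s (k : indices s) (nfk : k \notin frozen s)
    (c : indices s -> int) (i j : indices s) :
    (forall l, eps k l = (c l)%:~R) -> i != k -> j != k ->
  @eps_tilde (mutate nfk) i j = eps_tilde i j +
    ((mult k)%:Z * (neg_part (c i) * pos_part (c j) - pos_part (c i) * neg_part (c j)))%:~R.
Proof.
move=> epsk ik jk; rewrite /eps_tilde /= /mutate_eps.
have di0 : (mult i)%:R != 0 :> rat by rewrite pnatr_eq0 -lt0n mult_gt0.
have dgt0 l : 0 < (mult l)%:R :> rat by rewrite ltr0n mult_gt0.
pose t : rat := (mult k)%:R / (mult i)%:R.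
have t0 : 0 < t by rewrite divr_gt0.
have epsik : eps i k = - (t * (c i)%:~R).
  apply: (mulfI di0); rewrite -[LHS]/(eps_tilde i k) eps_tilde_skew /eps_tilde epsk.
  by rewrite /t; field.
rewrite ![k == _]eq_sym (negPf ik) (negPf jk) /= -abs_mul_opposite epsik epsk.
rewrite mulNr -mulrA -intrM oppr_le0 pmulr_rge0 // ler0z.
case: ifP => _; first by rewrite mulr0 addr0.
rewrite normrN normrM gtr0_norm // -intr_norm mulrDr; congr (_ + _).
by rewrite !intrM /t; field.
Qed.

Lemma W_pairing_mutation s (k : indices s) (nfk : k \notin frozen s)
    (F : fieldType) (M : zmodType) (B : K2 F -> rat -> M)
    (a : indices s -> units F) (a' : indices (mutate nfk) -> units F) :
    coefficient_pairing B ->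
    val (a k) * val (a' k) =
      \prod_(j : indices s | 0 < eps k j) val (a j) ^ Num.floor (eps k j)
      + \prod_(j : indices s | eps k j < 0) val (a j) ^ Num.floor (- eps k j) ->
    (forall i : indices s, i != k -> a' i = a i) ->
  W_pairing B a' = W_pairing B a.
Proof.
move=> pairingB exch a'E.
pose c (j : indices s) : int := Num.floor (eps k j).
have epsk j : eps k j = (c j)%:~R.
  by rewrite floorK // eps_int // (negPf nfk).
have ck : c k = 0 by rewrite /c eps_diag floor0.
have ekj j : eps_tilde k j = ((mult k)%:Z * c j)%:~R by rewrite /eps_tilde epsk intrM.
apply: (@symbol_sum_mutation F M B pairingB _ k a a' c (mult k)%:Z
  (@eps_tilde s) (@eps_tilde (mutate nfk))) => //.
- by move=> i; rewrite eps_tilde_skew ekj mulrNz.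
- by move=> j; rewrite /eps_tilde /= /mutate_eps eqxx mulrN.
- by move=> i; rewrite /eps_tilde /= /mutate_eps eqxx orbT mulrN.
- by move=> i j ik jk; exact: eps_tilde_mutate.
rewrite exch !val_units_sum; congr (_ + _); rewrite big_mkcond /=;
  apply: eq_bigr => j _.
  rewrite epsk ltr0z /pos_part intrKfloor.
  by case: ifP => [cj|/negbT]; [rewrite max_l // ltW | rewrite -leNgt => /max_r ->].
rewrite epsk ltrz0 /neg_part -mulrNz intrKfloor.
case: ifP => [cj|/negbT].
  by rewrite max_l // oppr_ge0 ltW.
by rewrite -leNgt -oppr_le0 => /max_r ->.
Qed.

Lemma W_pairing_isomorphism s s' (f : indices s -> indices s')
    (F : fieldType) (M : zmodType) (B : K2 F -> rat -> M)
    (a : indices s -> units F) (a' : indices s' -> units F) :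
  seed_isomorphism f -> (forall i, a' (f i) = a i) ->
  W_pairing B a' = W_pairing B a.
Proof.
move=> [f_bij _ fE fd] a'E.
have f_on : {on [pred _ | true], bijective f} by exact: onW_bij.
rewrite /W_pairing (reindex f) //; apply: eq_bigr => i _.
rewrite (reindex f) //; apply: eq_bigr => j _.
by rewrite !a'E /eps_tilde fE fd.
Qed.

(** The field F and the embedding chi are arbitrary so that, for a composite
phi o psi, the induction hypothesis on psi can be used along chi o phi, with all
symbols staying in the same K_2(F). *)
Lemma W_pairing_cluster s s' (phi : {rmorphism torus_field s' -> torus_field s}) :
    cluster_transformation phi ->
  forall (F : fieldType) (chi : {rmorphism torus_field s -> F})
    (M : zmodType) (B : K2 F -> rat -> M)
    (a : indices s -> units F) (a' : indices s' -> units F),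
    coefficient_pairing B ->
    (forall i, val (a i) = chi (Defs.coord i)) ->
    (forall i, val (a' i) = chi (phi (Defs.coord i))) ->
  W_pairing B a' = W_pairing B a.
Proof.
elim=> {s s' phi} [s k nfk phi [exch fixed]|s s' f phi f_iso phiE
    |s s' s'' phi psi _ IHphi _ IHpsi] F chi M B a a' pairingB aE a'E.
- apply: W_pairing_mutation => // [|i ik]; last first.
    by apply: val_inj; rewrite /= a'E fixed // aE.
  rewrite a'E aE -rmorphM exch rmorphD !rmorph_prod.
  by congr (_ + _); apply: eq_bigr => j _; rewrite aE fmorphXz.
- apply: (W_pairing_isomorphism _ f_iso) => i.
  by apply: val_inj; rewrite a'E phiE aE.
have N0 i : chi (phi (Defs.coord i)) != 0 by rewrite !fmorph_eq0 coord_neq0.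
pose b i := Units (N0 i).
transitivity (W_pairing B b); last exact: (IHphi F chi).
exact: (IHpsi F (chi \o phi)).
Qed.

Lemma W_pairing_coordinates (s s' : seed) (M : zmodType)
    (B : K2 (torus_field s) -> rat -> M) (a : indices s' -> units (torus_field s)) :
  coefficient_pairing B -> cluster_coordinates a ->
  W_pairing B a = W_pairing B (fun i => Units (coord_neq0 i)).
Proof.
move=> pairingB [phi phiC aE].
exact: (W_pairing_cluster phiC (chi := idfun)).
Qed.

Lemma tens_pairing (G : zmodType) : coefficient_pairing (@tens G rat).
Proof. by split=> [q|x q r _]; [exact: tensDl | exact: tensDr]. Qed.

Lemma floor_pairing (G : zmodType) :
  coefficient_pairing (fun (x : G) (q : rat) => x *~ Num.floor q).
Proof.
split=> [q x y|x q r r_int]; first exact: mulrzDl.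
by rewrite floorDrz // mulrzDr.
Qed.

End Invariance.

Unset Implicit Arguments.

Theorem corollary6p4 (s s1 s2 : seed)
    (a1 : indices s1 -> units (torus_field s))
    (a2 : indices s2 -> units (torus_field s)) :
  cluster_coordinates a1 -> cluster_coordinates a2 ->
  W_rat a1 = W_rat a2 /\
  (eps_tilde_integral s1 -> eps_tilde_integral s2 -> W_int a1 = W_int a2).
Proof.
move=> a1C a2C.
have invariant M B (pairingB : @coefficient_pairing _ M B) :
    W_pairing B a1 = W_pairing B a2.
  by rewrite !(W_pairing_coordinates pairingB).
split=> [|_ _]; first exact: invariant (tens_pairing _).
exact: invariant (floor_pairing _).
Qed.
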